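(* Let $n$ be a positive integer and consider the system in the unknowns $x_1,\ldots,x_{n+4}$: \[ x_i\cdot x_i=x_{i+1}\ (i\in\{1,\ldots,n\}),\quad x_{n+2}+1=x_1,\quad x_{n+3}+1=x_{n+2},\quad x_{n+3}\cdot x_{n+4}=x_{n+1}. \] This system is soluble in positive integers and has only finitely many solutions in integers. Every integer solution $(x_1,\ldots,x_{n+4})$ satisfies $|x_1|,\ldots,|x_{n+4}|\leqslant \left(2+2^{2^n}\right)^{2^n}$. The maximal solution in positive integers (each of its entries is at least the corresponding entry of any solution in positive integers) is given by \[ x_i=\left(2+2^{2^n}\right)^{2^{i-1}}\ (i\in\{1,\ldots,n+1\}),\quad x_{n+2}=1+2^{2^n},\quad x_{n+3}=2^{2^n},\quad x_{n+4}=\left(1+2^{2^n-1}\right)^{2^n}. \] *)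

(* Defs.v *)
From mathcomp Require Import all_boot all_order all_algebra.
From mathcomp Require Import classical_sets cardinality.

Set Implicit Arguments.
Unset Strict Implicit.
Unset Printing Implicit Defensive.

Import Order.TTheory GRing.Theory Num.Theory.

Local Open Scope ring_scope.

(* Coordinates are numbered from 1: [x _[i]] is the i-th coordinate of x,
   meaningful for 1 <= i <= size x only. *)
Definition coord1 (x : seq int) (i : nat) : int := nth 0 x i.-1.

Notation "x _[ i ]" := (coord1 x i)
  (at level 2, left associativity, format "x _[ i ]") : ring_scope.

Definition is_solution (n : nat) (x : (n + 4).-tuple int) : Prop :=
  [/\ forall i : nat, (1 <= i <= n)%N -> x _[i] * x _[i] = x _[i + 1],
      x _[n + 2] + 1 = x _[1],
      x _[n + 3] + 1 = x _[n + 2]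
    & x _[n + 3] * x _[n + 4] = x _[n + 1]].

Definition is_positive_solution (n : nat) (x : (n + 4).-tuple int) : Prop :=
  is_solution x /\ forall i : nat, (1 <= i <= n + 4)%N -> 0 < x _[i].

Definition is_maximal_positive_solution (n : nat) (m : (n + 4).-tuple int) :
    Prop :=
  is_positive_solution m /\
  forall x : (n + 4).-tuple int, is_positive_solution x ->
    forall i : nat, (1 <= i <= n + 4)%N -> x _[i] <= m _[i].

(* Main.v *)
(* Put N = 2^n and y = x_{n+3}. Then x_1 = y + 2 and x_i = (y + 2)^(2^(i-1)),
   so the last equation says y * x_{n+4} = (y + 2)^N. Modulo y this gives
   y | 2^N, whence |y| <= 2^N, and every bound follows. If y > 0 and
   2^N = y q, the maximality of x_{n+4} amounts to
   q (y + 2)^N <= (y q + 2)^N, which follows from the case N = 2. *)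
Require Import Defs.
From mathcomp Require Import all_boot all_order all_algebra.
From mathcomp Require Import classical_sets cardinality.
From mathcomp Require Import zify ring.

Set Implicit Arguments.
Unset Strict Implicit.
Unset Printing Implicit Defensive.

Import Order.TTheory GRing.Theory Num.Theory.

Local Open Scope classical_set_scope.
Local Open Scope ring_scope.

(** Adding [B] to an entry in [[-B, B]] lands in [[0, 2B]], so every such tuple is in the image
    under [g] of a tuple over the finite type ['I_K.+1]. *)
Lemma finite_bounded_tuples (k : nat) (B : int) :
  finite_set [set x : k.-tuple int |
    forall i : nat, (1 <= i <= k)%N -> `|x _[i]| <= B].
Proof.
pose K := (2 * absz B)%N.
pose g (t : k.-tuple 'I_K.+1) : k.-tuple int :=
  [tuple (tnth t j : nat)%:Z - B | j < k].
apply: (@sub_finite_set _ _ (range g)); last exact/finite_image/finite_finset.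
move=> x /= xB.
have {}xB (j : 'I_k) : - B <= tnth x j <= B.
  by have := xB j.+1; rewrite /coord1 /= -tnth_nth ltn_ord -ler_norml; apply.
exists [tuple inord (absz (tnth x j + B)) | j < k] => //.
apply: eq_from_tnth => j; rewrite !tnth_mktuple inordK; last first.
  by have := xB j; rewrite /K; lia.
by rewrite gez0_abs ?addrK // -lerBlDr sub0r; case/andP: (xB j).
Qed.

Lemma coord1_mktuple (k : nat) (f : nat -> int) (i : nat) :
  (1 <= i <= k)%N -> [tuple f j | j < k] _[i] = f i.-1.
Proof.
case: i => // i /= ik; rewrite /coord1 /=.
by have := nth_mktuple (fun j : 'I_k => f j) 0 (Ordinal ik).
Qed.

Lemma solution_coord1_pow (n : nat) (x : (n + 4).-tuple int) :
  is_solution x -> forall i : nat, (1 <= i <= n + 1)%N ->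
  x _[i] = (x _[n + 3] + 2) ^+ (2 ^ (i - 1)).
Proof.
case=> xsq x1 x2 _; elim=> // -[_ _|i IH ilt].
  by rewrite expr1 -x1 -x2 -addrA.
have -> : i.+2 = (i.+1 + 1)%N by rewrite addn1.
rewrite -xsq; last by lia.
rewrite IH; last by lia.
by rewrite -exprD addnn -mul2n addnK subn1 -expnS.
Qed.

(** The difference of the two N-th powers is divisible by the difference of their bases, which is
    [y]. *)
Lemma dvdz_exp_add (y c : int) (N : nat) :
  (y %| (y + c) ^+ N)%Z -> (y %| c ^+ N)%Z.
Proof.
have yD : (y %| (y + c) ^+ N - c ^+ N)%Z.
  by rewrite subrXX addrK dvdz_mulr ?dvdzz.
by move=> yN; rewrite -(subKr ((y + c) ^+ N) (c ^+ N)) rpredB.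
Qed.

Lemma solution_last (n : nat) (x : (n + 4).-tuple int) :
  is_solution x ->
  x _[n + 3] * x _[n + 4] = (x _[n + 3] + 2) ^+ (2 ^ n).
Proof.
move=> sx; have [_ _ _ ->] := sx.
by rewrite (solution_coord1_pow sx) ?addnK // leqnn addn1.
Qed.

Lemma solution_dvdz (n : nat) (x : (n + 4).-tuple int) :
  is_solution x -> (x _[n + 3] %| 2 ^+ (2 ^ n))%Z.
Proof.
move=> sx; apply: (@dvdz_exp_add _ 2).
by rewrite -solution_last // dvdz_mulr.
Qed.

Lemma dvdz_norm_le (d m : int) : m != 0 -> (d %| m)%Z -> `|d| <= `|m|.
Proof. by move=> m0 dm; apply: dvdn_leq; rewrite ?absz_gt0. Qed.

Lemma solution_norm_le (n : nat) (x : (n + 4).-tuple int) :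
  is_solution x -> `|x _[n + 3]| <= 2 ^+ (2 ^ n).
Proof.
move=> /solution_dvdz /dvdz_norm_le; rewrite expf_neq0 // => /(_ isT).
by rewrite [X in _ <= X]ger0_norm ?exprn_ge0.
Qed.

Lemma coord1_index_cases (n i : nat) : (1 <= i <= n + 4)%N ->
  [\/ (1 <= i <= n + 1)%N, i = (n + 2)%N, i = (n + 3)%N | i = (n + 4)%N].
Proof.
move=> ile; have [?|?] := leqP i (n + 1); first by constructor 1; lia.
have [->|?] := eqVneq i (n + 2)%N; first by constructor 2.
have [->|?] := eqVneq i (n + 3)%N; first by constructor 3.
by constructor 4; lia.
Qed.

Lemma solution_bound (n : nat) (x : (n + 4).-tuple int) :
  is_solution x -> forall i : nat, (1 <= i <= n + 4)%N ->
  `|x _[i]| <= (2 + 2 ^+ (2 ^ n)) ^+ (2 ^ n).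
Proof.
move=> sx; have yle := solution_norm_le sx; have yz := solution_last sx.
have y_dvd := solution_dvdz sx.
have [_ _ x2 _] := sx.
have N_gt0 : (0 < 2 ^ n)%N by rewrite expn_gt0.
move: x2 yle yz y_dvd; set y := x _[n + 3]; set P := 2 ^+ (2 ^ n).
set C := (2 + P) ^+ _ => x2 yle yz y_dvd.
have P_gt0 : 0 < P by rewrite exprn_gt0.
have PC : 2 + P <= C by rewrite ler_eXnr //; lia.
(* Since |y + 2| <= 2 + P and 2 + P >= 1, raising the exponent up to 2^n only enlarges the bound. *)
have powC k : (k <= 2 ^ n)%N -> `|(y + 2) ^+ k| <= C.
  move=> kN; rewrite normrX; apply: (@le_trans _ _ ((2 + P) ^+ k)).
    by rewrite lerXn2r ?nnegrE //; lia.
  by rewrite ler_weXn2l //; lia.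
move=> i /coord1_index_cases [ile| -> | -> | ->].
- rewrite (solution_coord1_pow sx ile); apply: powC.
  by rewrite leq_exp2l //; lia.
- by rewrite -x2; lia.
- by rewrite -/y; lia.
(* As a divisor of P, [y] is nonzero, so |y| >= 1 and the last coordinate is at most its product
   with [y] in absolute value, a power already bounded. *)
- have y0 : y != 0.
    apply: contraTneq y_dvd => ->.
    by rewrite dvd0z gt_eqF.
  apply: le_trans (powC _ (leqnn _)); rewrite -yz normrM.
  by rewrite ler_peMl // -gtz0_ge1 normr_gt0.
Qed.

(** Two of the N factors absorb [q]: for N = 2 the difference of the sides is (q - 1)(y^2 q - 4),
    nonnegative because y q >= 4. The other N - 2 factors compare by y <= y q. *)
Lemma mul_exp_add2_le (y q : int) (N : nat) :
  (1 < N)%N -> 0 < y -> 0 < q -> 4 <= y * q ->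
  q * (y + 2) ^+ N <= (y * q + 2) ^+ N.
Proof.
move=> /subnKC <- y_gt0 q_gt0 yq; rewrite !exprD mulrA.
have yleyq : y <= y * q by nia.
have sq : q * (y + 2) ^+ 2 <= (y * q + 2) ^+ 2.
  rewrite -subr_ge0 [X in 0 <= X](_ : _ = (q - 1) * (y * (y * q) - 4)).
    by rewrite mulr_ge0 //; nia.
  by ring.
apply: ler_pM => //.
- by rewrite mulr_ge0 ?exprn_ge0 //; lia.
- by rewrite exprn_ge0 //; lia.
- by rewrite lerXn2r ?nnegrE //; lia.
Qed.

(** The index [j] counts from 0, so it describes coordinate j + 1; hence the exponent 2^j in place
    of 2^(i-1). *)
Definition max_entry (n j : nat) : int :=
  if (j <= n)%N then (2 + 2 ^+ (2 ^ n)) ^+ (2 ^ j)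
  else if j == n.+1 then 1 + 2 ^+ (2 ^ n)
  else if j == n.+2 then 2 ^+ (2 ^ n)
  else (1 + 2 ^+ (2 ^ n - 1)) ^+ (2 ^ n).

Definition max_solution (n : nat) : (n + 4).-tuple int :=
  [tuple max_entry n j | j < n + 4].

Lemma max_solutionE (n : nat) :
  [/\ forall i : nat, (1 <= i <= n + 1)%N ->
        (max_solution n) _[i] = (2 + 2 ^+ (2 ^ n)) ^+ (2 ^ (i - 1)),
      (max_solution n) _[n + 2] = 1 + 2 ^+ (2 ^ n),
      (max_solution n) _[n + 3] = 2 ^+ (2 ^ n)
    & (max_solution n) _[n + 4] = (1 + 2 ^+ (2 ^ n - 1)) ^+ (2 ^ n)].
Proof.
split=> [i ile|||]; rewrite [LHS]coord1_mktuple /max_entry; try lia.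
- by rewrite ifT ?subn1 //; lia.
- by rewrite ifF ?ifT //; lia.
- by rewrite ifF 1?ifF 1?ifT //; lia.
- by rewrite !ifF //; lia.
Qed.

(** Both factors are N-th powers, and 2 (1 + 2^(N-1)) = 2 + 2^N. *)
Lemma exp2_mul_max_last (N : nat) : (0 < N)%N ->
  2 ^+ N * (1 + 2 ^+ (N - 1)) ^+ N = (2 + 2 ^+ N) ^+ N :> int.
Proof.
by case: N => // N _; rewrite subn1 -exprMn mulrDr mulr1 -exprS.
Qed.

Lemma max_solution_positive (n : nat) : is_positive_solution (max_solution n).
Proof.
have [m1 m2 m3 m4] := max_solutionE n.
have P_gt0 : 0 < 2 ^+ (2 ^ n) :> int by rewrite exprn_gt0.
split.
  split=> [i ile|||].
  - rewrite !m1 ?addnK; try lia.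
    by rewrite -exprD addnn -mul2n -expnS subn1 prednK //; lia.
  - rewrite m2 m1 ?subnn ?expr1; last by lia.
    by rewrite addrAC.
  - by rewrite m2 m3 addrC.
  - rewrite m3 m4 m1 ?addnK; last by lia.
    by rewrite exp2_mul_max_last // expn_gt0.
move=> i /coord1_index_cases [ile| -> | -> | ->].
- by rewrite m1 // exprn_gt0 //; lia.
- by rewrite m2; lia.
- by rewrite m3.
- by rewrite m4 exprn_gt0 // addr_gt0 ?exprn_gt0.
Qed.

Lemma max_solution_maximal (n : nat) : (0 < n)%N ->
  is_maximal_positive_solution (max_solution n).
Proof.
move=> n_gt0; split; first exact: max_solution_positive.
have [m1 m2 m3 m4] := max_solutionE n.
move=> x [sx x_gt0].
have yz := solution_last sx; have yle := solution_norm_le sx.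
have /dvdzP[q Pq] := solution_dvdz sx.
have y_gt0 : 0 < x _[n + 3] by apply: x_gt0; lia.
have [_ _ x2 _] := sx.
(* Here n > 0 enters: it gives N >= 2 and 2^N >= 4, as [mul_exp_add2_le] requires. *)
have N_gt1 : (1 < 2 ^ n)%N by rewrite -{1}(expn0 2) ltn_exp2l.
have P4 : 4 <= 2 ^+ (2 ^ n) :> int.
  by rewrite (_ : 4 = 2 ^+ 2) // ler_weXn2l.
move=> i /coord1_index_cases [ile| -> | -> | ->].
- rewrite m1 // (solution_coord1_pow sx ile) lerXn2r ?nnegrE //; lia.
- by rewrite m2 -x2; lia.
- by rewrite m3; lia.
- have := exp2_mul_max_last (ltnW N_gt1); rewrite m4.
  move: Pq P4 yz y_gt0; set y := x _[n + 3]; set z := x _[n + 4].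
  move: (2 ^ n)%N N_gt1 => N N_gt1 Pq P4 yz y_gt0.
  set w := (1 + _) ^+ N => Pw.
  have P_gt0 : 0 < 2 ^+ N :> int by rewrite exprn_gt0.
  (* Multiply z <= w by 2^N = q y: the left side becomes q (y z) = q (y + 2)^N, the right side (y q
     + 2)^N. *)
  rewrite -(ler_pM2l P_gt0) Pw addrC {1}Pq -mulrA yz Pq [q * y]mulrC.
  by apply: mul_exp_add2_le => //; nia.
Qed.

Theorem theorem2 (n : nat) (n_gt0 : (0 < n)%N) :
  [/\ exists x : (n + 4).-tuple int, is_positive_solution x,
      finite_set [set x : (n + 4).-tuple int | is_solution x],
      forall x : (n + 4).-tuple int, is_solution x ->
        forall i : nat, (1 <= i <= n + 4)%N ->
          `|x _[i]| <= (2 + 2 ^+ (2 ^ n)) ^+ (2 ^ n)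
    & exists m : (n + 4).-tuple int,
        is_maximal_positive_solution m /\
        [/\ forall i : nat, (1 <= i <= n + 1)%N ->
              m _[i] = (2 + 2 ^+ (2 ^ n)) ^+ (2 ^ (i - 1)),
            m _[n + 2] = 1 + 2 ^+ (2 ^ n),
            m _[n + 3] = 2 ^+ (2 ^ n)
          & m _[n + 4] = (1 + 2 ^+ (2 ^ n - 1)) ^+ (2 ^ n)]].
Proof.
split.
- by exists (max_solution n); exact: max_solution_positive.
(* Finiteness follows from the uniform bound on the entries. *)
- apply: sub_finite_set (finite_bounded_tuples (n + 4) _) => x /=.
  exact: solution_bound.
- exact: solution_bound.
- exists (max_solution n); split; first exact: max_solution_maximal.
  exact: max_solutionE.
Qed.
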